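(* Let $\mathbb F_q$ be a finite field with $q$ elements, let $n\ge 2$, let $a_1,\dots,a_n,b\in\mathbb F_q^*$ and let $k,k_1,\dots,k_n,m_1,\dots,m_n$ be positive integers. Let $N_q$ be the number of solutions $(x_1,\dots,x_n)\in\mathbb F_q^n$ of $$(a_1x_1^{m_1}+\dots+a_nx_n^{m_n})^k=bx_1^{k_1}\cdots x_n^{k_n}.$$ Let $d_j=\gcd(m_j,q-1)$, $M=\mathrm{lcm}[m_1,\dots,m_n]$ and $k_0=\gcd(k,k_1,\dots,k_n,q-1)$. Assume that for some $0\le t\le n$, $d_1,\dots,d_t$ are odd, $d_{t+1},\dots,d_n$ are even, and $d_1,\dots,d_t,d_{t+1}/2,\dots,d_n/2$ are pairwise coprime; that $b$ is a $k_0$th power in $\mathbb F_q$; and that $$\gcd\Bigl(\sum_{j=1}^n\frac{k_jM}{k_0m_j}-\frac{kM}{k_0},\ \frac{k_1(q-1)}{k_0d_1},\dots,\frac{k_n(q-1)}{k_0d_n},\ \frac{q-1}{k_0}\Bigr)=1.$$ Then: if $t=0$ and $n$ is even, $$N_q=q^{n-1}-1+\frac{(k_0-1)((q-1)^n-1)}{q}-k_0\eta((-1)^{n/2}a_1\cdots a_n)q^{(n-2)/2}-(k_0+q-1)\sum_{j=1}^{(n-2)/2}\eta((-1)^j)\sigma_{2j}(\eta(a_1),\dots,\eta(a_n))q^{j-1};$$ if $t=n$, $$N_q=q^{n-1}-(-1)^n+\frac{(k_0-1)((q-1)^n-(-1)^n)}{q};$$ otherwise $$N_q=q^{n-1}-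(-1)^n+\frac{(k_0-1)((q-1)^n-(-1)^n)}{q}-(-1)^n(k_0+q-1)\sum_{j=1}^{[(n-t)/2]}\eta((-1)^j)\sigma_{2j}(\eta(a_{t+1}),\dots,\eta(a_n))q^{j-1}.$$
   Context: For $q$ odd, $\eta$ is the quadratic character of $\mathbb F_q$: $\eta(x)=1,-1,0$ according as $x$ is a nonzero square, a nonsquare, or $0$ (in the cases where $\eta$ appears, some $d_j$ is even, so $q$ is odd). $\sigma_{2j}(z_1,\dots,z_r)$ denotes the elementary symmetric polynomial of degree $2j$ in $z_1,\dots,z_r$. $[x]$ denotes the integer part; empty sums are $0$. *)

(* Defs.v *)
From HB Require Import structures.
From mathcomp Require Import all_boot all_order all_algebra.
Set Implicit Arguments. Unset Strict Implicit. Unset Printing Implicit Defensive.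
Import Order.TTheory GRing.Theory Num.Theory.
Local Open Scope ring_scope.

(* quadratic character qeta of a finite field (meaningful for q odd):
   0 at 0, 1 on nonzero squares, -1 on nonsquares *)
Definition qeta (F : finFieldType) (x : F) : int :=
  if x == 0 then 0 else if [exists y : F, y ^+ 2 == x] then 1 else -1.

Definition elsym (R : comPzRingType) (s : seq R) (k : nat) : R :=
  \sum_(I : {set 'I_(size s)} | #|I| == k) \prod_(i in I) s`_i.

Definition Nsol (F : finFieldType) (n : nat) (a : 'I_n -> F) (b : F) (k : nat)
  (kk mm : 'I_n -> nat) : nat :=
  #|[set x : {ffun 'I_n -> F} |
      (\sum_(i < n) a i * x i ^+ mm i) ^+ k == b * \prod_(i < n) x i ^+ kk i]|.

Definition dj (F : finFieldType) (m : nat) : nat := gcdn m (#|F| - 1).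

Definition lcmM (n : nat) (mm : 'I_n -> nat) : nat := \big[lcmn/1%N]_(i < n) mm i.

Definition kzero (F : finFieldType) (n : nat) (k : nat) (kk : 'I_n -> nat) : nat :=
  gcdn k (gcdn (\big[gcdn/0%N]_(i < n) kk i) (#|F| - 1)).

(* Main.v *)
Require Import Defs.
From HB Require Import structures.
From mathcomp Require Import all_boot all_order all_algebra.
From mathcomp Require Import finfield cyclic ring zify.
Import Order.TTheory GRing.Theory Num.Theory.
Local Open Scope ring_scope.

Set Implicit Arguments.
Unset Strict Implicit.
Unset Printing Implicit Defensive.

(* Put T(x) = \sum_i a_i x_i^(m_i). A solution either has T(x) = 0 and a zero
   coordinate, or has all coordinates nonzero and T(x) != 0. On the set U of
   points of the second kind, x_i |-> x_i s^(M/m_i) w_i with w_i^(d_i) = 1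
   permutes U, and by the gcd hypothesis these maps multiply
   T(x)^k / (b \prod_i x_i^(k_i)) by an arbitrary k_0th power. As this quotient
   always is a k_0th power, it takes the value 1 on exactly k_0/(q-1) of U.
   What remains is to count the zeros of T, with all coordinates nonzero and
   without restriction. Since d_1, ..., d_t, d_(t+1)/2, ..., d_n/2 are pairwise
   coprime, the Chinese remainder theorem shows that the counts do not change
   when x_i^(m_i) is replaced by x_i for i <= t and by x_i^2 for i > t; those
   counts are additive convolutions of 1, the indicator of 0 and eta, where
   eta * eta = eta(-1) (q [0] - 1). *)

(** * Powers in a finite field, and scaling of points with nonzero coordinates *)

Lemma finField_expf_card1 (F : finFieldType) (x : F) :
  x != 0 -> x ^+ (#|F| - 1) = 1.
Proof.
move=> x0; apply: (mulfI x0); rewrite mulr1 -exprS subn1 prednK ?expf_card //.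
exact: ltnW (finNzRing_gt1 F).
Qed.

Lemma finField_expf_dvd (F : finFieldType) (x : F) (e : nat) :
  x != 0 -> (#|F| - 1 %| e)%N -> x ^+ e = 1.
Proof.
by move=> x0 /dvdnP[c ->]; rewrite mulnC exprM finField_expf_card1 // expr1n.
Qed.

Lemma finField_prim_root (F : finFieldType) :
  exists g : F, (#|F| - 1).-primitive_root g.
Proof.
have q1 : (0 < #|F| - 1)%N by rewrite subn_gt0 finNzRing_gt1.
pose s := enum [set x : F | x != 0].
have : has (#|F| - 1).-primitive_root s.
  apply: has_prim_root => //; last 1 first.
  - by rewrite -cardE cardsE subn1 -(cardC1 (0 : F)) leqnn.
  - apply/allP=> x; rewrite mem_enum inE => x0.
    by rewrite unity_rootE finField_expf_card1.
  - exact: enum_uniq.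
by case/hasP=> g _ gP; exists g.
Qed.

Lemma prim_root_neq0 (F : fieldType) (n : nat) (z : F) :
  n.-primitive_root z -> z != 0.
Proof.
move=> zP; apply/eqP=> z0; have := prim_expr_order zP.
rewrite z0 expr0n eqn0Ngt (prim_order_gt0 zP) => /esym/eqP.
by rewrite oner_eq0.
Qed.

Lemma card_expf_eq (F : finFieldType) (d : nat) (w : F) :
  (d %| #|F| - 1)%N -> w != 0 -> #|[set y : F | y ^+ d == w ^+ d]| = d.
Proof.
move=> dq w0; have [g gP] := finField_prim_root F.
have hP := dvdn_prim_root gP dq; set h := g ^+ _ in hP.
have -> : [set y : F | y ^+ d == w ^+ d] = [set w * h ^+ i | i : 'I_d].
  apply/setP=> y; rewrite inE; apply/eqP/imsetP => [yd | [i _ ->]].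
    have [|i hi] := prim_rootP hP (x := y / w).
      by rewrite expr_div_n yd divff // expf_neq0.
    by exists i => //; rewrite -hi mulrC divfK.
  by rewrite exprMn -exprM mulnC exprM (prim_expr_order hP) expr1n mulr1.
rewrite card_imset ?card_ord // => i j /(mulfI w0)/eqP.
by rewrite (eq_prim_root_expr hP) !modn_small // => /eqP/val_inj.
Qed.

Definition nzfun (F : finFieldType) (n : nat) (x : {ffun 'I_n -> F}) : bool :=
  [forall i, x i != 0].

Lemma card_nzfun (F : finFieldType) (n : nat) :
  #|[set x : {ffun 'I_n -> F} | nzfun x]| = ((#|F| - 1) ^ n)%N.
Proof.
rewrite -[in RHS](card_ord n) subn1 -(cardC1 (0 : F)) -card_ffun_on cardsE.
by apply: eq_card => x; rewrite !inE; apply: eq_forallb => i.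
Qed.

Definition scalef (F : finFieldType) (n : nat) (w x : {ffun 'I_n -> F}) :=
  [ffun i => x i * w i].

Lemma card_scalef (F : finFieldType) (n : nat) (w : {ffun 'I_n -> F})
    (P : pred {ffun 'I_n -> F}) :
  nzfun w -> #|[set x | P (scalef w x)]| = #|[set x | P x]|.
Proof.
move=> /forallP w0.
rewrite -[RHS](@card_preimset _ (scalef w)); last first.
  move=> x y /ffunP e; apply/ffunP=> i; have := e i.
  by rewrite !ffunE => /(mulIf (w0 i)).
by apply: eq_card => x; rewrite !inE.
Qed.

Lemma nzfun_scalef (F : finFieldType) (n : nat) (w x : {ffun 'I_n -> F}) :
  nzfun w -> nzfun (scalef w x) = nzfun x.
Proof.
move=> /forallP w0; apply: eq_forallb => i.
by rewrite ffunE mulf_eq0 negb_or w0 andbT.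
Qed.

(** * Scalings of the equation and equidistribution over k_0th powers *)

Section Equidistribution.

Variables (F : finFieldType) (n : nat) (a : 'I_n -> F) (b : F) (k : nat).
Variables (kk mm : 'I_n -> nat).

(* Scaling [x] by such a [c] multiplies [\sum_i a_i x_i^(m_i)] by [s], hence
   the quotient of the two sides of the equation by [h^-1]. *)
Definition scaling_ratio (h : F) : Prop :=
  exists c : {ffun 'I_n -> F}, exists s : F,
    [/\ s != 0, nzfun c, forall i, c i ^+ mm i = s
      & \prod_i c i ^+ kk i = h * s ^+ k].

Lemma scaling_ratio1 : scaling_ratio 1.
Proof.
exists [ffun=> 1], 1; split; rewrite ?oner_neq0 //.
- by apply/forallP=> i; rewrite ffunE oner_neq0.
- by move=> i; rewrite ffunE expr1n.
- by rewrite expr1n mulr1 big1 // => i _; rewrite ffunE expr1n.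
Qed.

Lemma scaling_ratioM h1 h2 :
  scaling_ratio h1 -> scaling_ratio h2 -> scaling_ratio (h1 * h2).
Proof.
move=> [c [s [s0 c0 cm ck]]] [d [r [r0 d0 dm dk]]].
exists (scalef c d), (r * s); split.
- by rewrite mulf_neq0.
- by rewrite nzfun_scalef.
- by move=> i; rewrite ffunE exprMn cm dm.
- under eq_bigr do rewrite ffunE exprMn.
  by rewrite big_split /= ck dk exprMn; ring.
Qed.

Lemma scaling_ratioV h : scaling_ratio h -> scaling_ratio h^-1.
Proof.
move=> [c [s [s0 c0 cm ck]]]; exists [ffun i => (c i)^-1], s^-1; split.
- by rewrite invr_eq0.
- by apply/forallP=> i; rewrite ffunE invr_eq0 (forallP c0).
- by move=> i; rewrite ffunE exprVn cm.
- under eq_bigr do rewrite ffunE exprVn.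
  by rewrite prodfV ck invfM exprVn.
Qed.

Lemma scaling_ratioX h e : scaling_ratio h -> scaling_ratio (h ^+ e).
Proof.
move=> hG; elim: e => [|e IH]; first exact: scaling_ratio1.
by rewrite exprS; apply: scaling_ratioM.
Qed.

(** The ratios form a group, so a Bezout relation u e = v f + gcd(e, f) yields the power h^gcd(e,
    f). *)
Lemma scaling_ratio_gcd h e f : h != 0 ->
  scaling_ratio (h ^+ e) -> scaling_ratio (h ^+ f) ->
  scaling_ratio (h ^+ gcdn e f).
Proof.
move=> h0 he hf; have [->|e0] := posnP e; first by rewrite gcd0n.
have [u v uv _] := egcdnP f e0.
have -> : h ^+ gcdn e f = h ^+ e ^+ u * (h ^+ f ^+ v)^-1.
  apply: (mulIf (expf_neq0 v (expf_neq0 f h0))).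
  rewrite divfK ?expf_neq0 // -!exprM -exprD; congr (h ^+ _).
  by rewrite addnC [(f * v)%N]mulnC [(e * u)%N]mulnC uv.
by apply: scaling_ratioM; [|apply: scaling_ratioV]; apply: scaling_ratioX.
Qed.

Lemma scaling_ratio_biggcd (I : finType) h (e : I -> nat) : h != 0 ->
  (forall i, scaling_ratio (h ^+ e i)) ->
  scaling_ratio (h ^+ \big[gcdn/0%N]_i e i).
Proof.
move=> h0 he; apply: (big_ind (fun e => scaling_ratio (h ^+ e))) => //.
  exact: scaling_ratio1.
by move=> x y; apply: scaling_ratio_gcd.
Qed.

Let M := lcmM mm.
Let k0 := kzero F k kk.
Let q1 := (#|F| - 1)%N.

Lemma dvd_lcmM i : (mm i %| M)%N.
Proof. by rewrite /M /lcmM (bigD1 i) //= dvdn_lcml. Qed.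

Lemma kzero_dvd_k : (k0 %| k)%N.
Proof. exact: dvdn_gcdl. Qed.

Lemma kzero_dvd_kk i : (k0 %| kk i)%N.
Proof.
apply: dvdn_trans (dvdn_gcdr _ _) _; apply: dvdn_trans (dvdn_gcdl _ _) _.
by rewrite (bigD1 i) //= dvdn_gcdl.
Qed.

Lemma kzero_dvd_card : (k0 %| q1)%N.
Proof. by apply: dvdn_trans (dvdn_gcdr _ _) _; exact: dvdn_gcdr. Qed.

(** The scaling c_i = y^(M/m_i) multiplies every term a_i x_i^(m_i) by the same s = y^M. The
    relation for [h] is in product form because the exponent \sum_i k_i M/m_i - kM may be
    negative. *)
Lemma scaling_ratio_common (y : F) : y != 0 -> (forall i, 0 < mm i)%N ->
  exists2 h, scaling_ratio h &
    y ^+ (\sum_i kk i * (M %/ mm i))%N = h * y ^+ (k * M).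
Proof.
move=> y0 m0; exists (y ^+ (\sum_i kk i * (M %/ mm i))%N / y ^+ (k * M)).
  exists [ffun i => y ^+ (M %/ mm i)], (y ^+ M); split.
  - exact: expf_neq0.
  - by apply/forallP=> i; rewrite ffunE expf_neq0.
  - by move=> i; rewrite ffunE -exprM divnK // dvd_lcmM.
  - rewrite -exprM mulnC divfK ?expf_neq0 // expr_sum.
    by apply: eq_bigr => i _; rewrite ffunE -exprM mulnC.
by rewrite divfK // expf_neq0.
Qed.

(** Only coordinate j is scaled, by y^((q-1)/d_j). As d_j divides m_j, the m_j-th power of this
    factor is 1, so the sum is fixed and s = 1. *)
Lemma scaling_ratio_single (y : F) j : y != 0 ->
  scaling_ratio (y ^+ (kk j * (q1 %/ dj F (mm j)))).
Proof.
move=> y0; exists [ffun i => if i == j then y ^+ (q1 %/ dj F (mm j)) else 1], 1.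
split; rewrite ?oner_neq0 //.
- by apply/forallP=> i; rewrite ffunE; case: (i == j); rewrite ?oner_neq0 ?expf_neq0.
- move=> i; rewrite ffunE; case: eqP => [->|_]; last by rewrite expr1n.
  rewrite -exprM finField_expf_dvd // -/q1 mulnC muln_divA ?dvdn_gcdr //.
  by rewrite mulnC -muln_divA ?dvdn_gcdl // dvdn_mulr.
- rewrite expr1n mulr1 (bigD1 j) //= big1 ?mulr1 => [|i ij].
    by rewrite ffunE eqxx -exprM mulnC.
  by rewrite ffunE (negPf ij) expr1n.
Qed.

Hypothesis mm_gt0 : forall i, (0 < mm i)%N.
Hypothesis gcd1 :
  gcdn `|(\sum_(j < n) ((kk j * M) %/ (k0 * mm j))%N%:Z
          - ((k * M) %/ k0)%N%:Z)%R|
       (gcdn (\big[gcdn/0%N]_(j < n) ((kk j * q1) %/ (k0 * dj F (mm j)))%N)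
             (q1 %/ k0)%N) = 1%N.

Lemma kzero_gt0 : (0 < k0)%N.
Proof. by apply: dvdn_gt0 kzero_dvd_card; rewrite subn_gt0 finNzRing_gt1. Qed.

(** Put h = y^(k_0). The three kinds of numbers in [gcd1] are exponents e for which h^e is a scaling
    ratio: by the common scaling, by the single-coordinate scalings, and because h^((q-1)/k_0) = 1.
    Their gcd being 1, h itself is one. *)
Lemma scaling_ratio_kzero (y : F) : y != 0 -> scaling_ratio (y ^+ k0).
Proof.
move=> y0; set h := y ^+ k0; have h0 : h != 0 by rewrite expf_neq0.
have kpos := kzero_gt0.
rewrite -[h]expr1 -gcd1; apply: scaling_ratio_gcd => //; last first.
  apply: scaling_ratio_gcd => //.
    apply: scaling_ratio_biggcd => // j; rewrite -exprM.
    have djq : (dj F (mm j) %| q1)%N by exact: dvdn_gcdr.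
    suff -> : (k0 * (kk j * q1 %/ (k0 * dj F (mm j))))%N
              = (kk j * (q1 %/ dj F (mm j)))%N by exact: scaling_ratio_single.
    have d0 : (0 < dj F (mm j))%N by rewrite gcdn_gt0 mm_gt0.
    case/dvdnP: djq => u ->; case/dvdnP: (kzero_dvd_kk j) => v ->.
    rewrite -/k0 mulnK // [(v * k0)%N]mulnC [(u * _)%N]mulnC mulnACA.
    by rewrite mulKn ?muln_gt0 ?kpos ?mm_gt0 // mulnA.
  rewrite -exprM mulnC divnK ?kzero_dvd_card // finField_expf_card1 //.
  exact: scaling_ratio1.
have [r rS] := scaling_ratio_common y0 mm_gt0.
set X := (\sum_(j < n) (kk j * M %/ (k0 * mm j)))%N.
have -> : (\sum_i kk i * (M %/ mm i) = k0 * X)%N.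
  rewrite big_distrr; apply: eq_bigr => i _ /=.
  case/dvdnP: (dvd_lcmM i) => u ->; case/dvdnP: (kzero_dvd_kk i) => v ->.
  rewrite -/k0 mulnK // [(v * k0)%N]mulnC [(u * _)%N]mulnC mulnACA.
  by rewrite mulKn ?muln_gt0 ?kpos ?mm_gt0 // mulnA.
have -> : \sum_(j < n) ((kk j * M) %/ (k0 * mm j))%N%:Z = X%:Z.
  by rewrite /X (big_morph Posz PoszD (erefl _)).
set Y := (k * M %/ k0)%N.
have -> : (k * M = k0 * Y)%N.
  by rewrite [RHS]mulnC divnK // dvdn_mulr // kzero_dvd_k.
rewrite !exprM -/h => rE.
(* Here [rE] says h^X = r h^Y; the absolute value in [gcd1] gives [r] or its inverse, according to
   the sign of X - Y. *)
have [XY|YX] := leqP Y X.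
  suff -> : h ^+ `|X%:Z - Y%:Z| = r by [].
  apply: (mulIf (expf_neq0 Y h0)).
  by rewrite -rE -exprD; congr (h ^+ _); lia.
suff -> : h ^+ `|X%:Z - Y%:Z| = r^-1 by apply: scaling_ratioV.
apply: (mulIf (expf_neq0 X h0)).
have -> : h ^+ `|X%:Z - Y%:Z| * h ^+ X = h ^+ Y.
  by rewrite -exprD; congr (h ^+ _); lia.
rewrite rE mulKf //; apply/eqP=> r0; move/eqP: rE.
by rewrite r0 mul0r expf_eq0 (negPf h0) andbF.
Qed.

Hypothesis k_gt0 : (0 < k)%N.
Hypothesis kk_gt0 : forall i, (0 < kk i)%N.
Hypothesis b_neq0 : b != 0.
Hypothesis b_pow : exists y : F, b = y ^+ k0.

Let T (x : {ffun 'I_n -> F}) := \sum_i a i * x i ^+ mm i.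
Let V (x : {ffun 'I_n -> F}) := b * \prod_i x i ^+ kk i.

Lemma prod_exp_eq0 (x : {ffun 'I_n -> F}) :
  (\prod_i x i ^+ kk i == 0) = ~~ nzfun x.
Proof.
rewrite negb_forall; apply/prodf_eq0/existsP => [[i _]|[i]].
  by rewrite expf_eq0 kk_gt0 => xi; exists i; rewrite negbK.
by rewrite negbK => xi; exists i => //; rewrite expf_eq0 kk_gt0.
Qed.

(** Substituting [scalef c x] for x, where [c] realises the ratio y^(k_0), multiplies T^k by s^k and
    V by y^(k_0) s^k; the common factor s^k cancels. *)
Lemma card_torus_scaled (y : F) : y != 0 ->
  #|[set x | (nzfun x && (T x != 0)) && (T x ^+ k == V x * y ^+ k0)]| =
  #|[set x | (nzfun x && (T x != 0)) && (T x ^+ k == V x)]|.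
Proof.
move=> /scaling_ratio_kzero[c [s [s0 c0 cm ck]]].
rewrite -[RHS](card_scalef _ c0); apply: eq_card => x; rewrite !inE nzfun_scalef //.
have -> : T (scalef c x) = s * T x.
  rewrite /T big_distrr; apply: eq_bigr => i _ /=.
  by rewrite ffunE exprMn cm; ring.
have -> : V (scalef c x) = V x * y ^+ k0 * s ^+ k.
  rewrite /V; under eq_bigr do rewrite ffunE exprMn.
  by rewrite big_split /= ck; ring.
rewrite mulf_eq0 (negPf s0) exprMn [_ * T x ^+ k]mulrC.
have -> : (T x ^+ k * s ^+ k == V x * y ^+ k0 * s ^+ k) =
  (T x ^+ k == V x * y ^+ k0) by exact: (inj_eq (mulIf (expf_neq0 k s0))).
by [].
Qed.

(** Summing the preceding count over all nonzero y gives the left side. In the other order, each x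
    with nonzero coordinates and T(x) != 0 is counted once per y with V(x) y^(k_0) = T(x)^k, that is
    k_0 times. *)
Lemma card_torus_kzero :
  (q1 * #|[set x | (nzfun x && (T x != 0%R)) && (T x ^+ k == V x)]| =
   k0 * #|[set x | nzfun x && (T x != 0%R)]|)%N.
Proof.
have -> : (q1 * #|[set x | (nzfun x && (T x != 0%R)) && (T x ^+ k == V x)]| =
  \sum_(y : F | y != 0%R)
     #|[set x | (nzfun x && (T x != 0%R)) && (T x ^+ k == (V x * y ^+ k0)%R)]|)%N.
  rewrite (eq_bigr _ card_torus_scaled) sum_nat_const.
  by rewrite /q1 subn1 -(cardC1 (0 : F)); congr (_ * _)%N; apply: eq_card.
under eq_bigr do rewrite -sum1_card big_set /=.
rewrite -[#|[set x | nzfun x && _]|]sum1_card big_set big_distrr /=.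
rewrite (exchange_big_dep (fun x => nzfun x && (T x != 0))) /=; last first.
  by move=> y x _ /andP[].
apply: eq_bigr => x /andP[x0 Tx]; rewrite muln1.
have [z bz] := b_pow.
have Vx : V x != 0 by rewrite mulf_neq0 // prod_exp_eq0 x0.
(* T^k / V is a k_0th power because k_0 divides k and every k_i, and b = z^(k_0). *)
have [w w0 wE] : exists2 w, w != 0 & T x ^+ k = V x * w ^+ k0.
  exists (T x ^+ (k %/ k0) / (z * \prod_i x i ^+ (kk i %/ k0))).
    rewrite mulf_neq0 ?expf_neq0 // invr_eq0 mulf_neq0 //.
      apply: contraNneq b_neq0 => z0; rewrite bz z0 expr0n.
      by rewrite (gtn_eqF kzero_gt0).
    apply/prodf_neq0 => i _; rewrite expf_neq0 //; exact: (forallP x0).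
  rewrite expr_div_n -exprM divnK ?kzero_dvd_k // exprMn -bz -prodrXl.
  under eq_bigr do rewrite -exprM divnK ?kzero_dvd_kk //.
  by rewrite mulrC divfK.
transitivity #|[set y : F | y ^+ k0 == w ^+ k0]|; last first.
  exact: card_expf_eq kzero_dvd_card w0.
rewrite -sum1_card big_set /=.
apply: eq_bigl => y; rewrite unfold_in /= x0 Tx wE /=.
have -> : (V x * w ^+ k0 == V x * y ^+ k0) = (w ^+ k0 == y ^+ k0).
  by exact: (inj_eq (mulfI Vx)).
rewrite eq_sym andbC unfold_in; case: eqVneq => //= e.
have := expf_neq0 k0 w0; rewrite e; apply: contraNneq => <-.
by rewrite expr0n (gtn_eqF kzero_gt0).
Qed.

(** Holds point by point. If T(x) = 0, the equation says that V(x) = 0, hence that some coordinate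
    vanishes; if T(x) != 0, it forces V(x) != 0. The form with two sums avoids truncated
    subtraction. *)
Lemma Nsol_decomp :
  (Nsol a b k kk mm
   + #|[set x : {ffun 'I_n -> F} | nzfun x && (T x == 0%R)]| =
   #|[set x : {ffun 'I_n -> F} | T x == 0%R]|
   + #|[set x | (nzfun x && (T x != 0%R)) && (T x ^+ k == V x)]|)%N.
Proof.
have cardE (P : pred {ffun 'I_n -> F}) : #|[set x | P x]| = (\sum_x P x)%N.
  by rewrite -sum1_card big_set /= big_mkcond; apply: eq_bigr => x _; rewrite unfold_in; case: (P x).
rewrite /Nsol !cardE -!big_split /=; apply: eq_bigr => x _.
rewrite -/(T x) -/(V x).
have V0 : (V x == 0) = ~~ nzfun x by rewrite mulf_eq0 (negPf b_neq0) prod_exp_eq0.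
have [T0|T0] := eqVneq (T x) 0.
  rewrite T0 expr0n (gtn_eqF k_gt0) eq_sym V0.
  by rewrite andbT andbF; case: (nzfun x).
rewrite andbF andbT addn0 add0n; case: eqVneq => [e|]; rewrite ?andbF ?andbT //.
by have := expf_neq0 k T0; rewrite e V0 negbK => ->.
Qed.

End Equidistribution.

(** * Diagonal equations with coprime exponents *)

Lemma chinese_family (I : eqType) (c r : I -> nat) (s : seq I) :
  uniq s -> {in s &, forall i j, i != j -> coprime (c i) (c j)} ->
  exists W, {in s, forall i, W = r i %[mod c i]}.
Proof.
elim: s => [|i s IH] /= => [_ _|/andP[nis us] co]; first by exists 0%N.
case: IH => // [j l js ls|W WP].
  by apply: co; rewrite inE (js, ls) orbT.
have cop : coprime (c i) (\prod_(j <- s) c j).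
  rewrite big_seq; apply: (big_ind (fun P => coprime (c i) P)).
  - exact: coprimen1.
  - by move=> x y cx cy; rewrite coprimeMr cx.
  - move=> j js; apply: co; rewrite ?inE ?eqxx ?js ?orbT //.
    by apply: contraNneq nis => ->.
exists (chinese (c i) (\prod_(j <- s) c j) (r i) W) => j.
rewrite inE => /orP[/eqP ->|js]; first exact: chinese_modl.
have dv : (c j %| \prod_(j <- s) c j)%N.
  by rewrite (big_rem j js) /= dvdn_mulr.
by rewrite -(modn_dvdm _ dv) chinese_modr // modn_dvdm // WP.
Qed.

(** By Bezout, gcd(m, q-1) is a multiple of m modulo q-1, and exponents of y matter only modulo
    q-1. *)
Lemma finField_exp_gcd (F : finFieldType) (m : nat) (y : F) :
  (0 < m)%N -> y != 0 -> exists2 w, w != 0 & y ^+ gcdn m (#|F| - 1) = w ^+ m.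
Proof.
move=> m0 y0; have [u v uv _] := egcdnP (#|F| - 1)%N m0.
exists (y ^+ u); first exact: expf_neq0.
by rewrite -exprM uv exprD [y ^+ (_ * _)]finField_expf_dvd ?dvdn_mull ?mul1r.
Qed.

Lemma finField_exp_modn (F : finFieldType) (m e f : nat) (g : F) :
  (0 < m)%N -> g != 0 -> e = f %[mod gcdn m (#|F| - 1)] ->
  exists2 w, w != 0 & g ^+ e = g ^+ f * w ^+ m.
Proof.
move=> m0 g0; wlog fe : e f / (f <= e)%N => [H|] ef.
  have [/H|/ltnW/H] := leqP f e; first exact.
  case=> // w w0 fE; exists w^-1; rewrite ?invr_eq0 //.
  by rewrite fE exprVn mulfK // expf_neq0.
move/eqP: ef; rewrite eqn_mod_dvd // => /dvdnP[l lE].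
have [w w0 wE] := finField_exp_gcd m0 (expf_neq0 l g0).
by exists w => //; rewrite -wE -exprM -lE -exprD subnKC.
Qed.

Definition expo (n t : nat) (i : 'I_n) : nat := if (i < t)%N then 1 else 2.

(** Write z_i = g^(v_i) and seek s = g^(2W). It suffices that v_i e_i = 2W modulo d_i, with e_i =
    [expo t i]. For even d_i, where e_i = 2, this follows from W = v_i modulo d_i/2; for odd d_i,
    from W = v_i/2 modulo d_i. The moduli are pairwise coprime, so W exists. *)
Lemma expo_scaling (F : finFieldType) (n t : nat) (mm : 'I_n -> nat)
    (z : {ffun 'I_n -> F}) :
  (forall i, 0 < mm i)%N ->
  (forall j : 'I_n, (j < t)%N -> odd (dj F (mm j))) ->
  (forall j : 'I_n, (t <= j)%N -> ~~ odd (dj F (mm j))) ->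
  (forall i j : 'I_n, i != j ->
     coprime (if (i < t)%N then dj F (mm i) else (dj F (mm i) %/ 2)%N)
             (if (j < t)%N then dj F (mm j) else (dj F (mm j) %/ 2)%N)) ->
  nzfun z ->
  exists2 s, s != 0 & exists2 w : {ffun 'I_n -> F}, nzfun w &
    forall i, z i ^+ expo t i = s * w i ^+ mm i.
Proof.
move=> m0 dodd deven dco /forallP z0.
have [g gP] := finField_prim_root F; have g0 := prim_root_neq0 gP.
have zg i : {v : 'I_(#|F| - 1) | z i = g ^+ v}.
  by apply: (prim_rootP gP); rewrite finField_expf_card1.
pose v i : nat := sval (zg i).
have zv i : z i = g ^+ v i by rewrite /v; case: (zg i).
(* For odd d, [uphalf d] = (d+1)/2 is the inverse of 2 modulo d. *)
pose r (i : 'I_n) := if (i < t)%N then (v i * uphalf (dj F (mm i)))%N else v i.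
have [W WP] := @chinese_family _ _ r (enum 'I_n) (enum_uniq _)
  (fun i j _ _ => dco i j).
exists (g ^+ (W * 2)); first exact: expf_neq0.
have wP i : exists w, (w != 0) && (z i ^+ expo t i == g ^+ (W * 2) * w ^+ mm i).
  suff : (v i * expo t i = W * 2 %[mod dj F (mm i)])%N.
    case/(finField_exp_modn (m0 i) g0) => w w0 wE; exists w.
    by rewrite w0 zv -exprM wE eqxx.
  have := WP i (mem_enum _ _); rewrite /r /expo; case: ltnP => it.
    have := odd_double_half (dj F (mm i)); rewrite dodd //.
    set d := dj _ _ => dE Wd; rewrite -(modnMml W) Wd modnMml -mulnA.
    rewrite uphalf_half dodd // (_ : ((1 + d./2) * 2 = 1 + d)%N); last by lia.
    by rewrite mulnDr addnC modnMDl.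
  have := odd_double_half (dj F (mm i)); rewrite (negPf (deven _ it)) add0n.
  set d := dj _ _ => dE; rewrite divn2 => Wd.
  by rewrite -dE -!muln2 -!muln_modl Wd.
exists [ffun i => xchoose (wP i)].
  by apply/forallP=> i; rewrite ffunE; case/andP: (xchooseP (wP i)).
by move=> i; rewrite ffunE; case/andP: (xchooseP (wP i)) => _ /eqP.
Qed.

Lemma dbl_count (S T : finType) (A : pred S) (B : pred T) (R : S -> T -> bool) :
  (\sum_(x | A x) #|[set y | B y & R x y]| =
   \sum_(y | B y) #|[set x | A x & R x y]|)%N.
Proof.
under eq_bigr do rewrite -sum1_card big_set /=.
under [RHS]eq_bigr do rewrite -sum1_card big_set /=.
rewrite (exchange_big_dep B) /=; last by move=> x y _ /andP[].
by apply: eq_bigr => y By; apply: eq_bigl => x; rewrite !unfold_in By.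
Qed.

(* Both counts below are evaluated through the sum over nonvanishing [z] of
   the number of [x] with [\sum_i a_i z_i^(e_i) x_i^(m_i) = 0]: in [x] the
   factor [z_i^(e_i)] is absorbed, in [z] the factor [x_i^(m_i)] is. *)
Lemma card_diag_transfer (F : finFieldType) (n : nat) (a : 'I_n -> F)
    (m e : 'I_n -> nat) (D : pred {ffun 'I_n -> F}) :
  (forall x y : {ffun 'I_n -> F},
     (forall i, (x i == 0) = (y i == 0)) -> D x = D y) ->
  (forall i, 0 < m i)%N ->
  (forall z : {ffun 'I_n -> F}, nzfun z ->
     exists2 s, s != 0 & exists2 w : {ffun 'I_n -> F}, nzfun w &
       forall i, z i ^+ e i = s * w i ^+ m i) ->
  (forall i (x : F), x != 0 -> exists2 y, y != 0 & x ^+ m i = y ^+ e i) ->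
  ((#|F| - 1) ^ n * #|[set x | D x & (\sum_i a i * x i ^+ m i == 0)%R]| =
   \sum_(x | D x) #|[set z : {ffun 'I_n -> F} | nzfun z &
      (\sum_i a i * (x i != 0)%:R * z i ^+ e i == 0)%R]|)%N.
Proof.
move=> DP m0 zP xP.
transitivity (\sum_(z : {ffun 'I_n -> F} | nzfun z)
  #|[set x : {ffun 'I_n -> F} | D x & (\sum_i a i * z i ^+ e i * x i ^+ m i == 0)%R]|)%N.
  rewrite -card_nzfun -sum_nat_const; under eq_bigl do rewrite inE; apply: eq_bigr => z nz.
  have [s s0 [w w0 zw]] := zP z nz.
  rewrite -(card_scalef _ w0); apply: eq_card => x; rewrite !inE.
  rewrite (DP (scalef w x) x) => [|i]; last first.
    by rewrite ffunE mulf_eq0 (negPf (forallP w0 i)) orbF.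
  congr (_ && _); rewrite -(mulrI_eq0 _ (lregP s0)) mulr_sumr.
  by congr (_ == 0); apply: eq_bigr => i _; rewrite ffunE zw exprMn; ring.
rewrite dbl_count; apply: eq_bigr => x Dx.
(* At a vanishing coordinate the indicator carries the zero, so y = 1 can be taken and y stays
   nowhere zero. *)
have yP i : exists y, (y != 0) && (x i ^+ m i == (x i != 0)%:R * y ^+ e i).
  have [->|x0] := eqVneq (x i) 0.
    by exists 1; rewrite oner_neq0 expr0n (gtn_eqF (m0 i)) mul0r eqxx.
  by have [y y0 ->] := xP i _ x0; exists y; rewrite y0 mul1r eqxx.
pose y := [ffun i => xchoose (yP i)].
have y0 : nzfun y.
  by apply/forallP=> i; rewrite ffunE; case/andP: (xchooseP (yP i)).
rewrite -[RHS](card_scalef _ y0); apply: eq_card => z; rewrite !inE.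
rewrite nzfun_scalef //; congr (_ && (_ == 0)); apply: eq_bigr => i _.
have /andP[_ /eqP->] := xchooseP (yP i).
by rewrite !ffunE exprMn; ring.
Qed.

(** [card_diag_transfer] applies to the exponents m_i and also to [expo t] in place of them, with
    the same right-hand side; the factor (q-1)^n then cancels. [D] may be any condition on the set
    of vanishing coordinates. *)
Lemma card_diag_expo (F : finFieldType) (n t : nat) (a : 'I_n -> F)
    (mm : 'I_n -> nat) (D : pred {ffun 'I_n -> F}) :
  (forall x y : {ffun 'I_n -> F},
     (forall i, (x i == 0) = (y i == 0)) -> D x = D y) ->
  (forall i, 0 < mm i)%N ->
  (forall j : 'I_n, (j < t)%N -> odd (dj F (mm j))) ->
  (forall j : 'I_n, (t <= j)%N -> ~~ odd (dj F (mm j))) ->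
  (forall i j : 'I_n, i != j ->
     coprime (if (i < t)%N then dj F (mm i) else (dj F (mm i) %/ 2)%N)
             (if (j < t)%N then dj F (mm j) else (dj F (mm j) %/ 2)%N)) ->
  #|[set x | D x & \sum_i a i * x i ^+ mm i == 0]| =
  #|[set x | D x & \sum_i a i * x i ^+ expo t i == 0]|.
Proof.
move=> DP m0 dodd deven dco.
have q0 : (0 < (#|F| - 1) ^ n)%N.
  by rewrite expn_gt0 subn_gt0 finNzRing_gt1.
apply/eqP; rewrite -(eqn_pmul2l q0); apply/eqP.
rewrite (@card_diag_transfer _ _ a mm (expo t) D DP m0).
- rewrite (@card_diag_transfer _ _ a (expo t) (expo t) D DP) //.
  + by move=> i; rewrite /expo; case: (i < t)%N.
  + move=> z nz; exists 1; rewrite ?oner_neq0 //; exists z => // i.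
    by rewrite mul1r.
  + by move=> i x x0; exists x.
- by move=> z; apply: expo_scaling.
- move=> i x x0; rewrite /expo; case: ltnP => it.
    by exists (x ^+ mm i); rewrite ?expf_neq0.
  (* An even d_i divides m_i, so m_i is even and x^(m_i) is a square. *)
  exists (x ^+ (mm i)./2); first exact: expf_neq0.
  rewrite -exprM muln2 even_halfK //.
  apply: contra (deven i it) => om.
  exact: dvdn_odd (dvdn_gcdl _ _) om.
Qed.

(** * Additive convolution *)

Lemma sum_ffunS (T : finType) (R : nmodType) (n : nat)
    (G : {ffun 'I_n.+1 -> T} -> R) :
  \sum_x G x =
  \sum_u \sum_(x : {ffun 'I_n -> T})
     G [ffun i => if unlift ord0 i is Some j then x j else u].
Proof.
rewrite pair_big /=.
pose cons (p : T * {ffun 'I_n -> T}) : {ffun 'I_n.+1 -> T} :=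
  [ffun i => if unlift ord0 i is Some j then p.2 j else p.1].
rewrite (reindex cons) //=.
exists (fun x => (x ord0, [ffun j => x (lift ord0 j)])) => [[u x] _|x _] /=.
  congr pair; first by rewrite ffunE unlift_none.
  by apply/ffunP=> j; rewrite !ffunE liftK.
by apply/ffunP=> i; rewrite ffunE; case: unliftP => [j|] ->; rewrite ?ffunE.
Qed.

Section Convolution.

Variables (F : finFieldType) (theta : F -> rat) (Q : rat).

Let q : rat := #|F|%:R.

Hypothesis theta_sum : \sum_u theta u = 0.
Hypothesis theta_conv :
  forall c, \sum_u theta u * theta (c - u) = Q * ((c == 0)%:R - q^-1).

(* In the algebra of functions on [F] under additive convolution, with unit
   the indicator of [0], [q^-1] is an idempotent killed by [theta], and
   [theta ^ 2 = Q * (1 - q^-1)]. So [profile P A B] convolve like the pairs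
   [(P, A + B * sqrt Q)]. *)
Definition profile (P A B : rat) (c : F) : rat :=
  P / q + A * ((c == 0)%:R - q^-1) + B * theta c.

Lemma card_neq0 : q != 0.
Proof. by rewrite pnatr_eq0 -lt0n ltnW // finNzRing_gt1. Qed.

Lemma sum_const_inv : \sum_(u : F) q^-1 = 1.
Proof. by rewrite sumr_const -[RHS](divff card_neq0) /q mulr_natl. Qed.

Lemma sum_delta (G : F -> rat) c : \sum_u (u == c)%:R * G u = G c.
Proof.
rewrite (bigD1 c) //= eqxx mul1r big1 ?addr0 // => u /negPf->.
by rewrite mul0r.
Qed.

Lemma sum_sub (G : F -> rat) c : \sum_u G (c - u) = \sum_u G u.
Proof.
by rewrite [RHS](reindex_inj (inj_comp (addrI c) oppr_inj)).
Qed.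

Lemma sum_profile P A B : \sum_u profile P A B u = P.
Proof.
rewrite /profile !big_split /= -!mulr_sumr theta_sum sumrB sum_const_inv.
under [X in A * (X - 1)]eq_bigr do rewrite -[_%:R]mulr1.
by rewrite (sum_delta (fun=> 1)) subrr !mulr0 mulr1 !addr0.
Qed.

Lemma profile_conv P A B P' A' B' c :
  \sum_u profile P A B u * profile P' A' B' (c - u) =
  profile (P * P') (A * A' + Q * (B * B')) (A * B' + B * A') c.
Proof.
have thetaP : \sum_u theta u * profile P' A' B' (c - u) =
    A' * theta c + B' * (Q * ((c == 0)%:R - q^-1)).
  rewrite -theta_conv mulr_sumr.
  have -> : A' * theta c = \sum_u A' * ((u == c)%:R * theta u).
    by rewrite -mulr_sumr sum_delta.
  transitivity (\sum_u (P' / q - A' / q) * theta u +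
      (\sum_u A' * ((u == c)%:R * theta u) +
       \sum_u B' * (theta u * theta (c - u)))).
    rewrite -!big_split /=; apply: eq_bigr => u _.
    by rewrite /profile subr_eq0 [c == u]eq_sym; ring.
  by rewrite -mulr_sumr theta_sum mulr0 add0r.
transitivity (\sum_u (P / q - A / q) * profile P' A' B' (c - u) +
    (\sum_u A * ((u == 0)%:R * profile P' A' B' (c - u)) +
     \sum_u B * (theta u * profile P' A' B' (c - u)))).
  rewrite -!big_split /=; apply: eq_bigr => u _.
  by rewrite {1}/profile; ring.
rewrite -!mulr_sumr sum_sub sum_profile thetaP.
rewrite (sum_delta (fun u => profile P' A' B' (c - u))) subr0 /profile.
by ring.
Qed.

(** The pairs (A_i, B_i) multiply like A_i + B_i sqrt Q. The even and odd parts of the polynomial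
    [p] give the two components of the product without adjoining a square root of Q. *)
Lemma sum_profile_prod (T : finType) (n : nat) (D : 'I_n -> pred T)
    (f : 'I_n -> T -> F) (P A B : 'I_n -> rat) (c : F) :
  (forall i u, \sum_x (D i x)%:R * (f i x == u)%:R = profile (P i) (A i) (B i) u) ->
  let p := \prod_i ((A i)%:P + B i *: 'X) in
  \sum_(x : {ffun 'I_n -> T})
     (\prod_i (D i (x i))%:R) * (\sum_i f i (x i) == c)%:R =
  profile (\prod_i P i) (even_poly p).[Q] (odd_poly p).[Q] c.
Proof.
elim: n D f P A B c => [|n IH] D f P A B c fP p.
  rewrite /p !big_ord0 even_polyC odd_polyC hornerC horner0.
  rewrite (eq_bigr (fun=> (c == 0)%:R)); last first.
    by move=> x _; rewrite !big_ord0 mul1r eq_sym.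
  rewrite sumr_const card_ffun card_ord expn0 mulr1n /profile; ring.
rewrite sum_ffunS /p !big_ord_recl.
set p' := \prod_(i < n) ((A (lift ord0 i))%:P + B (lift ord0 i) *: 'X).
have -> : even_poly (((A ord0)%:P + B ord0 *: 'X) * p') =
    A ord0 *: even_poly p' + B ord0 *: (odd_poly p' * 'X).
  rewrite mulrDl mul_polyC -scalerAl.
  by rewrite even_polyD !even_polyZ [_ * p']mulrC even_polyMX.
have -> : odd_poly (((A ord0)%:P + B ord0 *: 'X) * p') =
    A ord0 *: odd_poly p' + B ord0 *: even_poly p'.
  rewrite mulrDl mul_polyC -scalerAl.
  by rewrite odd_polyD !odd_polyZ [_ * p']mulrC odd_polyMX.
rewrite !hornerE.
have := IH (fun i => D (lift ord0 i)) (fun i => f (lift ord0 i))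
  (fun i => P (lift ord0 i)) (fun i => A (lift ord0 i))
  (fun i => B (lift ord0 i)) _ (fun i => fP (lift ord0 i)).
rewrite /= -/p' => IHc.
transitivity (\sum_u (D ord0 u)%:R * profile (\prod_(i < n) P (lift ord0 i))
    (even_poly p').[Q] (odd_poly p').[Q] (c - f ord0 u)).
  apply: eq_bigr => u _; rewrite -IHc mulr_sumr; apply: eq_bigr => x _.
  rewrite !big_ord_recl !ffunE unlift_none -mulrA; congr (_ * (_ * _)).
    by apply: eq_bigr => i _; rewrite ffunE liftK.
  under [X in f ord0 u + X]eq_bigr do rewrite ffunE liftK.
  by rewrite addrC -subr_eq0 -[in RHS]subr_eq0 opprB addrA addrAC.
transitivity (\sum_v profile (P ord0) (A ord0) (B ord0) v *
    profile (\prod_(i < n) P (lift ord0 i))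
    (even_poly p').[Q] (odd_poly p').[Q] (c - v)).
  under [RHS]eq_bigr do rewrite -fP mulr_suml.
  rewrite exchange_big; apply: eq_bigr => u _ /=.
  under [RHS]eq_bigr do rewrite mulrAC mulrC eq_sym.
  by rewrite (sum_delta (fun v => (D ord0 u)%:R * profile _ _ _ (c - v))).
by rewrite profile_conv; congr profile; ring.
Qed.

End Convolution.

(** Expand the product over the set [J] of factors that contribute -x X; only sets of size j reach
    degree j. *)
Lemma coef_prod_elsym (s : seq rat) (j : nat) :
  (\prod_(x <- s) (1 - x *: 'X))`_j = (-1) ^+ j * elsym s j.
Proof.
rewrite (big_nth 0) big_mkord.
under eq_bigr do rewrite addrC.
rewrite bigA_distr coef_sum /elsym mulr_sumr [RHS]big_mkcond /=.
rewrite [LHS]big_mkcond; apply: eq_bigr => J _ /=.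
rewrite -big_mkcond /=.
have -> : \prod_(i in J) - (s`_i *: 'X) =
    ((-1) ^+ #|J| * \prod_(i in J) s`_i) *: 'X^(#|J|) :> {poly rat}.
  under eq_bigr do rewrite -scaleNr -mul_polyC.
  rewrite big_split /= prodr_const -rmorph_prod prodrN mul_polyC.
  by [].
by rewrite coefZ coefXn eq_sym; case: eqP => [->|]; rewrite ?mulr1 ?mulr0.
Qed.

(** * The quadratic character *)

Section QuadraticCharacter.

Variable F : finFieldType.

Hypothesis q_odd : ~~ odd (#|F| - 1).

Let q : rat := #|F|%:R.

Definition qetaQ (x : F) : rat := (qeta x)%:~R.

Lemma dvd2_card : (2 %| #|F| - 1)%N.
Proof. by rewrite dvdn2. Qed.

Lemma qetaQ0 : qetaQ 0 = 0.
Proof. by rewrite /qetaQ /qeta eqxx. Qed.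

(** Since q-1 is even, the parity of an exponent of g is well defined, and the nonzero squares are
    the even powers. Multiplicativity of the character follows from this. *)
Lemma qetaQ_prim (g : F) i :
  (#|F| - 1).-primitive_root g -> qetaQ (g ^+ i) = (-1) ^+ i.
Proof.
move=> gP; have g0 := prim_root_neq0 gP.
rewrite /qetaQ /qeta (negPf (expf_neq0 i g0)) -signr_odd.
have -> : [exists y : F, y ^+ 2 == g ^+ i] = ~~ odd i; last by case: odd.
apply/existsP/idP => [[y /eqP yi]|i_even]; last first.
  by exists (g ^+ i./2); rewrite -exprM muln2 even_halfK.
have y0 : y != 0.
  by apply: contraTneq (expf_neq0 i g0) => y0; rewrite -yi y0 expr0n eqxx.
have [|j yj] := prim_rootP gP (x := y); first by rewrite finField_expf_card1.
move/eqP: yi; rewrite yj -exprM (eq_prim_root_expr gP) => /eqP ji.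
have := congr1 (modn^~ 2) ji; rewrite !modn_dvdm ?dvd2_card // !modn2 oddM andbF.
by case: odd.
Qed.

Lemma qetaQM x y : qetaQ (x * y) = qetaQ x * qetaQ y.
Proof.
have [->|x0] := eqVneq x 0; first by rewrite !mul0r qetaQ0 mul0r.
have [->|y0] := eqVneq y 0; first by rewrite !mulr0 qetaQ0 mulr0.
have [g gP] := finField_prim_root F.
have [|i ->] := prim_rootP gP (x := x); first by rewrite finField_expf_card1.
have [|j ->] := prim_rootP gP (x := y); first by rewrite finField_expf_card1.
by rewrite -exprD !(qetaQ_prim _ gP) exprD.
Qed.

Lemma qetaQ1 : qetaQ 1 = 1.
Proof.
have [g gP] := finField_prim_root F.
by rewrite -(expr0 g) (qetaQ_prim _ gP).
Qed.

Lemma qetaQX x i : qetaQ (x ^+ i) = qetaQ x ^+ i.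
Proof.
elim: i => [|i IH]; first by rewrite !expr0 qetaQ1.
by rewrite !exprS qetaQM IH.
Qed.

Lemma qetaQ_prod (I : finType) (x : I -> F) :
  qetaQ (\prod_i x i) = \prod_i qetaQ (x i).
Proof. exact: (big_morph _ qetaQM qetaQ1). Qed.

Lemma qetaQ_sqr x : qetaQ x ^+ 2 = (x != 0)%:R.
Proof.
have [->|x0] := eqVneq x 0; first by rewrite qetaQ0 expr0n.
by rewrite /qetaQ /qeta (negPf x0); case: ifP.
Qed.

(** Multiplying the variable by a generator, a nonsquare, permutes F and negates the sum. *)
Lemma qetaQ_sum : \sum_u qetaQ u = 0.
Proof.
have [g gP] := finField_prim_root F; have g0 := prim_root_neq0 gP.
have : \sum_u qetaQ u = - \sum_u qetaQ u.
  rewrite {1}(reindex_inj (mulfI g0)) -sumrN; apply: eq_bigr => u _.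
  by rewrite qetaQM -[g]expr1 (qetaQ_prim _ gP) expr1 mulN1r.
by move/eqP; rewrite -subr_eq0 opprK -mulr2n mulrn_eq0 => /eqP.
Qed.

(** For c = 0 each u != 0 contributes eta(-u^2) = eta(-1). For c != 0 the term at u != 0 is eta(u)^2
    eta(c/u - 1), and c/u - 1 takes every value but -1; the total is -eta(-1), since eta sums to
    0. *)
Lemma qetaQ_conv c :
  \sum_u qetaQ u * qetaQ (c - u) = qetaQ (-1) * q * ((c == 0)%:R - q^-1).
Proof.
have q0 : q != 0 by apply: card_neq0.
have -> : qetaQ (-1) * q * ((c == 0)%:R - q^-1)
          = qetaQ (-1) * (q * (c == 0)%:R - 1) by field.
have [->|c0] := eqVneq c 0.
  rewrite mulr1; under eq_bigr do rewrite sub0r -mulN1r qetaQM mulrCA -expr2 qetaQ_sqr.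
  rewrite -mulr_sumr (bigD1 0) //= eqxx add0r; congr (_ * _).
  under eq_bigr => u u0 do rewrite u0.
  by rewrite sumr_const cardC1 -subn1 natrB // ltnW // finNzRing_gt1.
rewrite mulr0 sub0r mulrN1 (bigD1 0) //= qetaQ0 mul0r add0r.
transitivity (\sum_(u | u != 0) qetaQ (c / u - 1)).
  apply: eq_bigr => u u0; rewrite -[RHS]mul1r -(_ : qetaQ u ^+ 2 = 1).
    by rewrite expr2 -!qetaQM; congr qetaQ; field.
  by rewrite qetaQ_sqr u0.
rewrite (reindex_onto (fun v => c / (v + 1)) (fun u => c / u - 1)) /=.
  rewrite (eq_bigl (fun v => v != -1)) => [|v].
    under eq_bigr => v v1.
      have v10 : v + 1 != 0 by rewrite addr_eq0.
      have -> : c / (c / (v + 1)) - 1 = v by field; rewrite c0 v10.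
      over.
    have := qetaQ_sum; rewrite (bigD1 (-1)) //= => /eqP.
    by rewrite addrC addr_eq0 => /eqP.
  have [->|v1] := eqVneq v (-1); first by rewrite addNr invr0 mulr0 eqxx.
  have v10 : v + 1 != 0 by rewrite addr_eq0.
  rewrite mulf_neq0 ?invr_eq0 //=; apply/eqP; field; by rewrite c0 v10.
by move=> u u0; rewrite subrK invf_div mulrC divfK.
Qed.

(** For u != 0 there are 1 + eta(u/a) square roots of u/a, and eta(u/a) = eta(a u) because eta(a)^2
    = 1. *)
Lemma card_square_fiber (a u : F) : a != 0 ->
  \sum_(x : F) (x != 0)%:R * (a * x ^+ 2 == u)%:R =
  (u != 0)%:R * (1 + qetaQ a * qetaQ u).
Proof.
move=> a0.
have [->|u0] := eqVneq u 0.
  rewrite mul0r big1 // => x _; case: eqVneq => [|x0]; rewrite ?mul0r //.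
  by rewrite mulf_eq0 (negPf a0) expf_eq0 (negPf x0) andbF mulr0.
rewrite mul1r -qetaQM.
have -> : \sum_(x : F) (x != 0)%:R * (a * x ^+ 2 == u)%:R
          = #|[set x : F | x ^+ 2 == u / a]|%:R :> rat.
  rewrite -sum1_card big_set /= natr_sum [RHS]big_mkcond /=.
  apply: eq_bigr => x _; rewrite unfold_in.
  have -> : (x ^+ 2 == u / a) = (a * x ^+ 2 == u).
    by rewrite -(inj_eq (mulfI a0)) [a * (u / a)]mulrC divfK.
  have [->|x0] := eqVneq x 0; last by rewrite mul1r; case: ifP.
  by rewrite expr0n mulr0 eq_sym (negPf u0) mulr0.
have -> : qetaQ (a * u) = qetaQ (u / a).
  have a1 : qetaQ a ^+ 2 = 1 by rewrite qetaQ_sqr a0.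
  by rewrite -[RHS]mul1r -a1 -qetaQX -qetaQM; congr qetaQ; field.
have ua0 : u / a != 0 by rewrite mulf_neq0 ?invr_eq0.
rewrite /qetaQ /qeta (negPf ua0); case: existsP => [[y /eqP yE]|nex].
  have y0 : y != 0.
    by apply: contraNneq ua0 => y0; rewrite -yE y0 expr0n.
  by rewrite -yE card_expf_eq ?dvd2_card.
rewrite (_ : [set _ | _] = set0) ?cards0 //.
by apply/setP=> x; rewrite !inE; apply/negP=> xE; apply: nex; exists x.
Qed.

End QuadraticCharacter.

(** * Counting solutions *)

Lemma card_linear_fiber (F : finFieldType) (a u : F) : a != 0 ->
  \sum_(x : F) (x != 0)%:R * (a * x ^+ 1 == u)%:R = (u != 0)%:R :> rat.
Proof.
move=> a0; rewrite (bigD1 (u / a)) //= expr1 [a * _]mulrC divfK // eqxx mulr1.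
rewrite mulf_eq0 invr_eq0 (negPf a0) orbF big1 ?addr0 // => x xu.
case: (a * x =P u) => [uE|_]; last by rewrite mulr0.
by case/eqP: xu; rewrite -uE mulrAC divff // mul1r.
Qed.

Lemma elsym0 (s : seq rat) : elsym s 0 = 1.
Proof.
rewrite /elsym (big_pred1 set0) ?big_set0 // => J.
by rewrite cards_eq0.
Qed.

Lemma elsym_size (s : seq rat) : elsym s (size s) = \prod_(x <- s) x.
Proof.
rewrite /elsym (big_pred1 setT) => [|J].
  by rewrite (big_nth 0) big_mkord; apply: eq_bigl => i; rewrite inE.
rewrite /= eqEcard subsetT cardsT card_ord eqn_leq.
by have := max_card (mem J); rewrite card_ord => ->.
Qed.

(** The even part keeps the coefficients of degree 2j, whose signs (-1)^(2j) are 1; the degree is at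
    most [size s], so j stops at its half. *)
Lemma horner_even_prod_elsym (s : seq rat) (Q : rat) :
  (even_poly (\prod_(x <- s) (1 - x *: 'X))).[Q] =
  \sum_(0 <= j < (size s)./2.+1) elsym s (2 * j) * Q ^+ j.
Proof.
set p := \prod_(x <- s) _.
have sp : (size p <= (size s).+1)%N.
  rewrite /p; elim: (s) => [|x s' IH]; first by rewrite big_nil size_poly1.
  rewrite big_cons; apply: leq_trans (size_polyMleq _ _) _.
  have : (size (1 - x *: 'X : {poly rat})%R <= 2)%N.
    rewrite (leq_trans (size_polyD _ _)) // geq_max size_poly1 size_polyN.
    by rewrite (leq_trans (size_scale_leq _ _)) // size_polyX.
  by move=> s1; rewrite -subn1 leq_subLR; exact: leq_add s1 IH.
rewrite (horner_coef_wide (n := (size s)./2.+1)); last first.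
  apply: leq_trans (size_even_poly _) _.
  by rewrite uphalfE; exact: (@half_leq _ (size s).+2).
rewrite big_mkord; apply: eq_bigr => j _.
by rewrite coef_even_poly coef_prod_elsym -mul2n exprM sqrrN !expr1n mul1r.
Qed.

Lemma horner_even_polyXn (R : comNzRingType) (n : nat) (Q : R) :
  (even_poly 'X^n).[Q] = if odd n then 0 else Q ^+ n./2.
Proof.
have -> : even_poly 'X^n = if odd n then 0 else 'X^(n./2) :> {poly R}.
  apply/polyP=> i; rewrite coef_even_poly coefXn.
  case: ifP => on; rewrite ?coef0 ?coefXn.
    by case: eqP => // e; rewrite -e odd_double in on.
  rewrite -[X in _.*2 == X](odd_double_half n) on add0n.
  by rewrite (inj_eq double_inj).
by case: odd; rewrite ?horner0 ?hornerXn.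
Qed.

Section Counting.

Variables (F : finFieldType) (theta : F -> rat) (Q : rat).

Let q : rat := #|F|%:R.

Hypothesis theta0 : theta 0 = 0.
Hypothesis theta_sum : \sum_u theta u = 0.
Hypothesis theta_conv :
  forall c, \sum_u theta u * theta (c - u) = Q * ((c == 0)%:R - q^-1).

Variables (n : nat) (a : 'I_n -> F) (e : 'I_n -> nat) (B : 'I_n -> rat).

Hypothesis e_gt0 : forall i, (0 < e i)%N.
Hypothesis fiber : forall i u,
  \sum_(x : F) (x != 0)%:R * (a i * x ^+ e i == u)%:R =
  (u != 0)%:R + B i * theta u.

(** Since [u != 0] = (q-1)/q - ([u = 0] - 1/q), each fiber count is a profile with P = q-1 and A =
    -1. At c = 0 the [theta] term of the product drops out. *)
Lemma card_diag_torus :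
  #|[set x : {ffun 'I_n -> F} | nzfun x & \sum_i a i * x i ^+ e i == 0]|%:R =
  (q - 1) ^+ n / q
  + (even_poly (\prod_i ((-1)%:P + B i *: 'X))).[Q] * (1 - q^-1).
Proof.
have q0 : q != 0 by apply: card_neq0.
have fP i u : \sum_(x : F) (x != 0)%:R * (a i * x ^+ e i == u)%:R =
    profile theta (q - 1) (-1) (B i) u.
  by rewrite fiber /profile; case: eqP => _ /=; field.
have := sum_profile_prod theta_sum theta_conv
  (D := fun i x => x != 0) (f := fun i x => a i * x ^+ e i) 0 fP.
rewrite /= /profile theta0 mulr0 addr0 eqxx prodr_const card_ord => <-.
rewrite -sum1_card big_set natr_sum /= big_mkcond /=; apply: eq_bigr => x _.
rewrite unfold_in; case: eqP; rewrite ?andbF ?andbT ?mulr0 ?mulr1 // => _.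
rewrite -natr_prod; case: ifP => [/forallP x0|/negbT].
  by rewrite big1 // => i _; rewrite x0.
by rewrite negb_forall => /existsP[i /negbTE xi]; rewrite (bigD1 i) //= xi.
Qed.

(** Admitting x = 0 adds [u = 0] to a fiber count and turns it into 1 + B_i theta(u), a profile with
    A = 0. The product is then a multiple of X^n, with zero even part for odd n. *)
Lemma card_diag_affine :
  #|[set x : {ffun 'I_n -> F} | \sum_i a i * x i ^+ e i == 0]|%:R =
  q ^+ n / q
  + (if odd n then 0 else \prod_i B i * Q ^+ n./2) * (1 - q^-1).
Proof.
have q0 : q != 0 by apply: card_neq0.
have fP i u : \sum_(x : F) true%:R * (a i * x ^+ e i == u)%:R =
    profile theta q 0 (B i) u.
  have := fiber i u; rewrite (bigD1 0) //= eqxx mul0r add0r => fE.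
  rewrite (bigD1 0) //= mul1r expr0n (gtn_eqF (e_gt0 i)) mulr0.
  transitivity ((0 == u)%:R + ((u != 0)%:R + B i * theta u)).
    congr (_ + _); rewrite -fE; apply: eq_bigr => x x0; by rewrite x0.
  by rewrite /profile eq_sym; case: eqP => _ /=; field.
have := sum_profile_prod theta_sum theta_conv
  (D := fun i => xpredT) (f := fun i x => a i * x ^+ e i) 0 fP.
rewrite /= /profile theta0 mulr0 addr0 eqxx [\prod_(i < n) q]prodr_const card_ord.
have -> : \prod_i (0%:P + B i *: 'X) = (\prod_i B i) *: 'X^n.
  under eq_bigr do rewrite polyC0 add0r -mul_polyC.
  by rewrite big_split /= prodr_const card_ord -rmorph_prod mul_polyC.
rewrite even_polyZ hornerZ horner_even_polyXn.
have -> : (if odd n then 0 else \prod_i B i * Q ^+ n./2) =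
  \prod_i B i * (if odd n then 0 else Q ^+ n./2).
  by case: odd; rewrite ?mulr0.
rewrite /q => <-; rewrite -sum1_card big_set natr_sum /= big_mkcond /=.
apply: eq_bigr => x _; rewrite big1 // mul1r unfold_in.
by case: ifP.
Qed.

End Counting.

(** * The number of solutions in terms of the two counts of zeros *)

Section Main.

Variables (F : finFieldType) (n : nat) (a : 'I_n -> F) (b : F) (k : nat).
Variables (kk mm : 'I_n -> nat) (t : nat).

Hypothesis a_neq0 : forall i, a i != 0.
Hypothesis b_neq0 : b != 0.
Hypothesis k_gt0 : (0 < k)%N.
Hypothesis kk_gt0 : forall i, (0 < kk i)%N.
Hypothesis mm_gt0 : forall i, (0 < mm i)%N.
Hypothesis dj_odd : forall j : 'I_n, (j < t)%N -> odd (dj F (mm j)).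
Hypothesis dj_even : forall j : 'I_n, (t <= j)%N -> ~~ odd (dj F (mm j)).
Hypothesis dj_coprime : forall i j : 'I_n, i != j ->
  coprime (if (i < t)%N then dj F (mm i) else (dj F (mm i) %/ 2)%N)
          (if (j < t)%N then dj F (mm j) else (dj F (mm j) %/ 2)%N).
Hypothesis b_pow : exists y : F, b = y ^+ kzero F k kk.
Hypothesis gcd1 :
  gcdn `|(\sum_(j < n) ((kk j * lcmM mm) %/ (kzero F k kk * mm j))%N%:Z
          - ((k * lcmM mm) %/ kzero F k kk)%N%:Z)%R|
       (gcdn (\big[gcdn/0%N]_(j < n)
                 ((kk j * (#|F| - 1)) %/ (kzero F k kk * dj F (mm j)))%N)
             ((#|F| - 1) %/ kzero F k kk)%N) = 1%N.

Let q : rat := (#|F|)%:R.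
Let k0 : rat := (kzero F k kk)%:R.

Let e : 'I_n -> nat := expo t.

(** With Z zeros of T in all, S of them with no zero coordinate, the decomposition gives N = Z +
    k_0((q-1)^n - S)/(q-1) - S. So S enters with the factor -(k_0+q-1)/(q-1), whose denominator
    cancels against 1 - 1/q in the term with [E]. *)
Lemma Nsol_diag (E : rat) :
  #|[set x : {ffun 'I_n -> F} | nzfun x & \sum_i a i * x i ^+ e i == 0]|%:R =
    (q - 1) ^+ n / q + E * (1 - q^-1) ->
  (Nsol a b k kk mm)%:R =
  #|[set x : {ffun 'I_n -> F} | \sum_i a i * x i ^+ e i == 0]|%:R
  + (k0 - 1) * (q - 1) ^+ n / q - (k0 + q - 1) * (E / q).
Proof.
have q0 : q != 0 by apply: card_neq0.
have F1 : (0 < #|F| - 1)%N by rewrite subn_gt0 finNzRing_gt1.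
have qE : (#|F| - 1)%N%:R = q - 1 :> rat by rewrite natrB // ltnW // finNzRing_gt1.
have q10 : q - 1 != 0 by rewrite -qE pnatr_eq0 -lt0n.
have cardD D DP := @card_diag_expo F n t a mm D DP mm_gt0 dj_odd dj_even dj_coprime.
have nzP (x y : {ffun 'I_n -> F}) :
    (forall i, (x i == 0) = (y i == 0)) -> nzfun x = nzfun y.
  by move=> xy; apply: eq_forallb => i; rewrite xy.
rewrite -(cardD _ nzP) -(cardD xpredT) //.
set S := #|[set x : {ffun 'I_n -> F} | nzfun x & _]|.
move=> SE.
have := Nsol_decomp a mm k_gt0 kk_gt0 b_neq0; rewrite -/S.
set Z := #|[set x : {ffun 'I_n -> F} | _]|; set W := #|[set x | _ && (_ == _)]|.
have := card_torus_kzero a mm_gt0 gcd1 kk_gt0 b_neq0 b_pow; rewrite -/W.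
set U := #|[set x : {ffun 'I_n -> F} | nzfun x & _]|.
have US : (S + U = (#|F| - 1) ^ n)%N.
  rewrite -card_nzfun -[RHS](cardsID [set x : {ffun 'I_n -> F} |
    \sum_i a i * x i ^+ mm i == 0]); congr (_ + _)%N.
    by apply: eq_card => x; rewrite !inE.
  by apply: eq_card => x; rewrite !inE andbC.
move=> /(congr1 (GRing.natmul (1 : rat))); rewrite !natrM qE => WU.
move=> /(congr1 (GRing.natmul (1 : rat))); rewrite !natrD => NE.
move: US => /(congr1 (GRing.natmul (1 : rat))); rewrite natrD natrX qE => US.
have -> : (Nsol a b k kk mm)%:R = Z%:R + W%:R - S%:R :> rat.
  by rewrite -NE addrK.
have -> : W%:R = k0 * U%:R / (q - 1) :> rat.
  by rewrite -WU mulrC mulKf.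
have -> : U%:R = (q - 1) ^+ n - S%:R :> rat by rewrite -US addrC addKr.
by rewrite SE; field; rewrite q0 q10.
Qed.

(** All exponents become 1 and the fibers are linear, so theta = 0 and Q = 0 suffice; this includes
    even q. Then E = (-1)^n. *)
Lemma Nsol_odd : (0 < n)%N -> t = n ->
  (Nsol a b k kk mm)%:R =
  q ^+ (n - 1)%N - (-1) ^+ n + (k0 - 1) * ((q - 1) ^+ n - (-1) ^+ n) / q.
Proof.
move=> n0 tn; have q0 : q != 0 by apply: card_neq0.
have th_sum : \sum_(u : F) (0 : rat) = 0 by rewrite big1.
have th_conv (c : F) : \sum_(u : F) (0 * 0 : rat) = 0 * ((c == 0)%:R - q^-1).
  by rewrite big1 ?mul0r // => u _; rewrite mul0r.
have e_gt0 i : (0 < e i)%N by rewrite /e /expo; case: (i < t)%N.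
have fiber i u : \sum_(x : F) (x != 0)%:R * (a i * x ^+ e i == u)%:R =
    (u != 0)%:R + 0 * 0 :> rat.
  by rewrite /e /expo tn ltn_ord mul0r addr0 card_linear_fiber.
rewrite (Nsol_diag (@card_diag_torus _ (fun=> 0) 0 (erefl 0) th_sum th_conv
  _ a e (fun=> 0) fiber)).
rewrite (@card_diag_affine _ (fun=> 0) 0 (erefl 0) th_sum th_conv
  _ a e (fun=> 0) e_gt0 fiber).
rewrite prodr_const card_ord expr0n (gtn_eqF n0) mul0r if_same mul0r addr0.
under eq_bigr do rewrite scale0r addr0.
rewrite prodr_const card_ord -polyC_exp even_polyC hornerC.
by rewrite -[in q ^+ n](prednK n0) exprS subn1; field.
Qed.

(** Covers both cases with some d_j even. The conditional term comes from the count of all zeros of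
    T, which can differ from q^(n-1) only when n is even and every exponent is 2. *)
Lemma Nsol_even : (0 < n)%N -> (t < n)%N ->
  let s := [seq (qeta (a i))%:~R : rat |
              i <- [seq i : 'I_n <- enum 'I_n | (t <= i)%N]] in
  let Sum m := \sum_(1 <= j < m.+1)
     (qeta ((-1 : F) ^+ j))%:~R * elsym s (2 * j)%N * q ^+ (j - 1)%N in
  (Nsol a b k kk mm)%:R =
  q ^+ (n - 1)%N - (-1) ^+ n + (k0 - 1) * ((q - 1) ^+ n - (-1) ^+ n) / q
  + (if (t == 0)%N && ~~ odd n then
       (q - 1) * (qeta ((-1) ^+ (n %/ 2)%N * \prod_(i < n) a i))%:~R
       * q ^+ ((n - 2) %/ 2)%N
     else 0)
  - (-1) ^+ n * (k0 + q - 1) * Sum ((n - t) %/ 2)%N.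
Proof.
move=> n0 tn s Sum; have q0 : q != 0 by apply: card_neq0.
(* An even d_j exists because t < n, and it divides q-1. *)
have q_odd : ~~ odd (#|F| - 1).
  apply: contra (dj_even (j := Ordinal tn) (leqnn t)).
  exact: dvdn_odd (dvdn_gcdr _ _).
have e_gt0 i : (0 < e i)%N by rewrite /e /expo; case: (i < t)%N.
pose B (i : 'I_n) : rat := if (i < t)%N then 0 else qetaQ (a i).
have fiber i u : \sum_(x : F) (x != 0)%:R * (a i * x ^+ e i == u)%:R =
    (u != 0)%:R + B i * qetaQ u :> rat.
  rewrite /e /expo /B; case: ltnP => it; last first.
    rewrite card_square_fiber //; case: eqVneq => [->|]; last by rewrite mul1r.
    by rewrite mul0r qetaQ0 mulr0 addr0.
  by rewrite mul0r addr0 card_linear_fiber.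
have thS := qetaQ_sum q_odd; have thC := qetaQ_conv q_odd.
rewrite (Nsol_diag (card_diag_torus (qetaQ0 F) thS thC fiber)).
rewrite (card_diag_affine (qetaQ0 F) thS thC e_gt0 fiber).
set Q := qetaQ (-1) * _.
have size_s : size s = (n - t)%N.
  rewrite size_map size_filter -(count_map val (leq t)) val_enum_ord.
  rewrite -{1}(subnKC (ltnW tn)) iotaD add0n count_cat.
  rewrite (eq_in_count (a2 := pred0)) => [|j]; last first.
    by rewrite mem_iota add0n /= => /ltn_geF.
  rewrite count_pred0 add0n (eq_in_count (a2 := predT)) => [|j]; last first.
    by rewrite mem_iota => /andP[].
  by rewrite count_predT size_iota.
have -> : \prod_i ((-1)%:P + B i *: 'X) =
    (-1) ^+ n *: \prod_(x <- s) (1 - x *: 'X) :> {poly rat}.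
  rewrite /s big_map big_filter big_enum_cond /= [in RHS]big_mkcond /=.
  rewrite -[X in (-1) ^+ X](card_ord n) -prodr_const -scaler_prod.
  apply: eq_bigr => i _; rewrite /B -/(qetaQ _) scaleN1r ltnNge.
  by case: leqP => _ /=; rewrite ?scale0r ?addr0 polyCN ?opprB 1?addrC.
rewrite even_polyZ hornerZ horner_even_prod_elsym size_s -(divn2 (n - t)).
(* As Q = eta(-1) q, one factor q comes out of every Q^j with j >= 1, which leaves q^(j-1). *)
have -> : \sum_(0 <= j < ((n - t) %/ 2).+1) elsym s (2 * j) * Q ^+ j =
    1 + q * Sum ((n - t) %/ 2)%N.
  rewrite big_ltn // elsym0 mulr1; congr (_ + _).
  rewrite /Sum mulr_sumr !big_add1; apply: eq_bigr => j _.
  rewrite -/(qetaQ _) qetaQX // exprMn subn1 exprSr [in LHS]exprS /=.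
  by ring.
have -> : \prod_i B i = if (t == 0)%N then qetaQ (\prod_i a i) else 0.
  case: posnP => [t0|tpos].
    rewrite qetaQ_prod //; apply: eq_bigr => i _; by rewrite /B t0.
  have n00 : (0 < n)%N by [].
  by rewrite (bigD1 (Ordinal n00)) //= /B /= tpos mul0r.
rewrite -/(qetaQ _) qetaQM // qetaQX //.
have -> : q ^+ n = q * q ^+ (n - 1) by rewrite -exprS subn1 prednK.
case: eqP => [t0|_] /=; last by rewrite mul0r if_same mul0r addr0; field.
case: (boolP (odd n)) => on /=; first by rewrite mul0r addr0; field.
have n2 : (n %/ 2 = ((n - 2) %/ 2).+1)%N.
  by move: on n0; lia.
rewrite -(divn2 n) /Q exprMn n2 [q ^+ _.+1]exprS; field; exact: q0.
Qed.

End Main.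

Theorem theorem3 (F : finFieldType) (n : nat) (a : 'I_n -> F) (b : F)
  (k : nat) (kk mm : 'I_n -> nat) (t : nat) :
  (2 <= n)%N ->
  (forall i, a i != 0) -> b != 0 ->
  (0 < k)%N -> (forall i, 0 < kk i)%N -> (forall i, 0 < mm i)%N ->
  (t <= n)%N ->
  (forall j : 'I_n, (j < t)%N -> odd (dj F (mm j))) ->
  (forall j : 'I_n, (t <= j)%N -> ~~ odd (dj F (mm j))) ->
  (forall i j : 'I_n, i != j ->
     coprime (if (i < t)%N then dj F (mm i) else (dj F (mm i) %/ 2)%N)
             (if (j < t)%N then dj F (mm j) else (dj F (mm j) %/ 2)%N)) ->
  (exists y : F, b = y ^+ kzero F k kk) ->
  gcdn `|(\sum_(j < n) ((kk j * lcmM mm) %/ (kzero F k kk * mm j))%N%:Z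
          - ((k * lcmM mm) %/ kzero F k kk)%N%:Z)%R|
       (gcdn (\big[gcdn/0%N]_(j < n)
                 ((kk j * (#|F| - 1)) %/ (kzero F k kk * dj F (mm j)))%N)
             ((#|F| - 1) %/ kzero F k kk)%N) = 1%N ->
  let q : rat := (#|F|)%:R in
  let k0 : rat := (kzero F k kk)%:R in
  let N : rat := (Nsol a b k kk mm)%:R in
  [/\ (t == 0)%N && ~~ odd n ->
        N = q ^+ (n - 1)%N - 1 + (k0 - 1) * ((q - 1) ^+ n - 1) / q
            - k0 * (qeta ((-1) ^+ (n %/ 2)%N * \prod_(i < n) a i))%:~R
                 * q ^+ ((n - 2) %/ 2)%N
            - (k0 + q - 1) *
              \sum_(1 <= j < ((n - 2) %/ 2)%N.+1)
                 (qeta ((-1 : F) ^+ j))%:~R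
                 * elsym [seq (qeta (a i))%:~R : rat | i <- enum 'I_n] (2 * j)%N
                 * q ^+ (j - 1)%N,
      (t == n) ->
        N = q ^+ (n - 1)%N - (-1) ^+ n + (k0 - 1) * ((q - 1) ^+ n - (-1) ^+ n) / q
    & ~~ ((t == 0)%N && ~~ odd n) -> t != n ->
        N = q ^+ (n - 1)%N - (-1) ^+ n + (k0 - 1) * ((q - 1) ^+ n - (-1) ^+ n) / q
            - (-1) ^+ n * (k0 + q - 1) *
              \sum_(1 <= j < ((n - t) %/ 2)%N.+1)
                 (qeta ((-1 : F) ^+ j))%:~R
                 * elsym [seq (qeta (a i))%:~R : rat | i <- [seq i : 'I_n <- enum 'I_n | (t <= i)%N]]
                        (2 * j)%N
                 * q ^+ (j - 1)%N].
Proof.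
move=> n2 a0 b0 k0 kk0 m0 tn dodd deven dco bk gcd1 q kz N.
have n0 : (0 < n)%N := ltnW n2.
have N_odd := Nsol_odd a0 b0 k0 kk0 m0 dodd deven dco bk gcd1 n0.
have N_even := Nsol_even a0 b0 k0 kk0 m0 dodd deven dco bk gcd1 n0.
split.
- case/andP=> /eqP t0 n_even; rewrite /N N_even ?t0 // eqxx n_even /=.
  have q_odd : ~~ odd (#|F| - 1).
    apply: contra (deven (Ordinal n0) _); last by rewrite t0.
    exact: dvdn_odd (dvdn_gcdr _ _).
  have hE : (n %/ 2 = ((n - 2) %/ 2).+1)%N by move: n2 n_even; lia.
  (* The term j = n/2 of the sum is split off: its symmetric function is the product of all
     eta(a_i), so it merges with the conditional term, and (q-1) - (k_0+q-1) = -k_0. *)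
  rewrite subn0 filter_predT [in X in _ - _ * X]hE big_nat_recr //=.
  set s := [seq _ | i <- _]; set S := \sum_(1 <= j < _) _.
  have size_s : size s = (2 * ((n - 2) %/ 2).+1)%N.
    by rewrite size_map size_enum_ord -hE; move: n_even; lia.
  rewrite -size_s elsym_size (_ : \prod_(x <- s) x = qetaQ (\prod_i a i)).
    rewrite -!/(qetaQ _) qetaQM // hE [(_.+1 - 1)%N]subn1 /=.
    by rewrite -signr_odd (negPf n_even) -/q -/kz; ring.
  by rewrite big_map big_enum qetaQ_prod.
- by move/eqP=> tE; rewrite /N N_odd.
- move=> /negPf t0n tn'; rewrite /N N_even ?ltn_neqAle ?tn' //.
  by rewrite t0n addr0.
Qed.
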